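(* Fix $p\in(-\infty,\infty)\setminus\{0,1\}$. For all $n\ge1$ and all $f:\{0,1\}^n\to\mathbb{R}_+$ with $\mathbb{E}[f^p]=1$ (and $f>0$ if $p<1$) we have $$\frac1n\,\mathrm{sgn}(p-1)\,\mathcal{E}(f,f^{p-1})\ge b_p\left(\frac1n\,\mathrm{Ent}(f^p)\right),$$ where $b_p$ is a convex increasing function with values in $[0,\infty)$ given by $$b_p(\ln2-h(y))=\frac{\mathrm{sgn}(p-1)}{2}\left(1-y^{\frac1p}(1-y)^{1-\frac1p}-y^{1-\frac1p}(1-y)^{\frac1p}\right),\qquad 0<y\le\tfrac12,$$ extended for $p>1$ to the point $\ln 2$ (corresponding to $y=0$) by continuity, i.e. $b_p(\ln 2)=\frac12$. (Thus $b_p$ is defined on $[0,\ln2]$ for $p>1$ and on $[0,\ln2)$ for $p<1$.)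
   Context: All expectations and $\mathrm{Ent}$ are with respect to the uniform probability measure on $\{0,1\}^n$; $\mathrm{Ent}(g)=\mathbb{E}\left[g\ln\frac{g}{\mathbb{E}[g]}\right]$ with $0\ln0=0$. $\mathbb{R}_+=[0,\infty)$. The Dirichlet form on $\{0,1\}^n$ is $\mathcal{E}(f,g)=-\frac12\,\mathbb{E}[(\triangle f)\,g]$, with $\triangle f(x)=\sum_{y:\,y\sim x}(f(y)-f(x))$, where $x\sim y$ means that $x,y$ differ in precisely one coordinate. $h(x)=-x\ln x-(1-x)\ln(1-x)$ is the binary entropy function (natural logarithm), and $\mathrm{sgn}$ is the sign function. *)

(* Defs.v *)
From HB Require Import structures.
From mathcomp Require Import all_boot all_order all_algebra.
From mathcomp Require Import all_classical all_reals all_analysis.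

Set Implicit Arguments.
Unset Strict Implicit.
Unset Printing Implicit Defensive.

Import Order.TTheory GRing.Theory Num.Theory.
Import numFieldNormedType.Exports.

Local Open Scope ring_scope.

Definition cube (n : nat) : finType := {ffun 'I_n -> bool}.

Section Cube.
Variables (R : realType) (n : nat).
Implicit Types f g : cube n -> R.

Definition expect f : R := (\sum_x f x) / #|cube n|%:R.

(* The library sets [ln 0 = 0] and [x / 0 = 0], so [0 ln 0 = 0] and the entropy
   of the zero function is 0. *)
Definition Ent g : R := expect (fun x => g x * ln (g x / expect g)).

Definition adj (x y : cube n) : bool := #|[set i | x i != y i]| == 1%N.

Definition laplacian f : cube n -> R :=
  fun x => \sum_(y | adj y x) (f y - f x).

Definition dirichlet f g : R :=
  - 2^-1 * expect (fun x => laplacian f x * g x).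

(* [0 `^ a = 0] in the library for every [a != 0], negative [a] included; only
   [a > 0] or [f > 0] is meaningful here. *)
Definition fpow f (a : R) : cube n -> R := fun x => f x `^ a.

End Cube.

Section RateFunction.
Variable R : realType.

Definition binent (x : R) : R := - (x * ln x) - (1 - x) * ln (1 - x).

Definition b_formula (p y : R) : R :=
  Num.sg (p - 1) / 2
  * (1 - y `^ p^-1 * (1 - y) `^ (1 - p^-1)
       - y `^ (1 - p^-1) * (1 - y) `^ p^-1).

Definition b_dom (p : R) : interval R :=
  if 1 < p then `[0, ln 2] else `[0, ln 2[.

End RateFunction.

(* Main.v *)
Require Import Defs.
From HB Require Import structures.
From mathcomp Require Import all_boot all_order all_algebra.
From mathcomp Require Import all_classical all_reals all_analysis.
From mathcomp Require Import ring lra.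
Import Order.TTheory GRing.Theory Num.Theory.
Import numFieldNormedType.Exports.
Local Open Scope classical_set_scope.
Local Open Scope ring_scope.

(** The inequality is an equality for n = 1, and the general case follows from
it by tensorization: both sides split over the n directions of the cube.

Substitute y = 1 / (1 + e^(2t)) with t >= 0, so that y / (1 - y) = e^(-2t).
Then ln 2 - h(y) becomes U(t) = t tanh t - ln cosh t ([entropy_profile]), the
formula for b_p becomes B(t) = sgn(p-1)/2 (1 - cosh(ct) / cosh t) with
c = 2/p - 1 ([energy_profile]), and one computes U'(t) = t / cosh^2 t and
B'(t) = s(t) U'(t), where, with S(x) = sinh x / x,
  s(t) = |p-1| / p^2 (S(2t/p) + S((2 - 2/p) t))     ([slope]).
The function S is at least 1, even, and nondecreasing on the nonnegative reals;
hence s is positive and nondecreasing, and every tangent line of the curve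
(U, B) lies below the curve ([energy_profile_tangent]).  The function b_p is
B composed with the inverse of U ([rate]); being a supremum of lines of
positive slope, it is convex and increasing.

Now fix a line k + s u below the graph of b_p, with s >= 0.
- On one edge, a^p and b^p can be written M e^t / cosh t and M e^(-t) / cosh t,
  where M is their mean.  The energy of the edge is then exactly M B(t) and its
  entropy M U(t), so the energy is at least k M + s times the entropy
  ([two_point]; an edge with a zero endpoint is the limit of large t).
- The Dirichlet form is the sum over the n directions of the mean energy of the
  edges in this direction ([dirichlet_flip]), the mean of M is 1, and entropy is
  subadditive: Ent is at most the sum over the directions of the mean entropy of
  the edges ([Ent_le_sum_cond_ent]).  Summing, the normalized energy is at least
  k + s Ent / n ([minorant_dirichlet]).
It remains to take the tangent line at the point Ent / n, or to let the point
of tangency tend to ln 2 if Ent / n = ln 2.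

Subadditivity of entropy is obtained by averaging g over one coordinate after
another until the constant E[g] is reached; by the inequality of Gibbs, each
step lowers E[g ln G], where G is the current average, by at most the mean edge
entropy of g itself in this direction ([gibbs_cond_ent]). *)

Set Implicit Arguments.
Unset Strict Implicit.

(** * Derivatives and monotonicity *)

Section Derivatives.
Variable R : realType.
Implicit Types (f g : R -> R) (x a b k : R).

Lemma is_derive_add f g x a b : is_derive x 1 f a -> is_derive x 1 g b ->
  is_derive x 1 (fun t => f t + g t) (a + b).
Proof. exact: is_deriveD. Qed.

Lemma is_derive_sub f g x a b : is_derive x 1 f a -> is_derive x 1 g b ->
  is_derive x 1 (fun t => f t - g t) (a - b).
Proof. exact: is_deriveB. Qed.

Lemma is_derive_mul f g x a b : is_derive x 1 f a -> is_derive x 1 g b ->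
  is_derive x 1 (fun t => f t * g t) (f x * b + g x * a).
Proof. exact: is_deriveM. Qed.

Lemma is_derive_scale f k x a : is_derive x 1 f a ->
  is_derive x 1 (fun t => k * f t) (k * a).
Proof. exact: is_deriveZ. Qed.

Lemma is_derive_dilation f k x a : is_derive (k * x) 1 f a ->
  is_derive x 1 (fun t => f (k * t)) (k * a).
Proof.
move=> df; rewrite mulrC.
have dk : is_derive x (1 : R) (fun t : R => k * t) k.
  have := is_derive_scale k (is_derive_id x (1 : R)).
  by rewrite mulr1.
exact: (is_derive1_comp df dk).
Qed.

Lemma is_derive_within f g a b : (forall x, is_derive x 1 f (g x)) ->
  {within `[a, b], continuous f}.
Proof.
move=> df; apply: derivable_within_continuous => x _.
by case: (df x).
Qed.

Lemma nondecreasing_is_derive f g a b : (forall x, is_derive x 1 f (g x)) ->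
  (forall x, a < x < b -> 0 <= g x) -> a <= b -> f a <= f b.
Proof.
move=> df g0 ab; apply: (@ger0_derive1_ndecr _ f a b) => //.
- move=> x; rewrite in_itv/= => xab.
  by rewrite derive1E; have [_ ->] := df x; exact: g0.
- exact: is_derive_within df.
Qed.

Lemma increasing_is_derive f g a b : (forall x, is_derive x 1 f (g x)) ->
  (forall x, a < x < b -> 0 < g x) -> a < b -> f a < f b.
Proof.
move=> df g0 ab; apply: (@gtr0_derive1_lt_cc _ f a b) => //.
- move=> x; rewrite in_itv/= => xab.
  by rewrite derive1E; have [_ ->] := df x; exact: g0.
- exact: is_derive_within df.
- by rewrite in_itv/= lexx ltW.
- by rewrite in_itv/= lexx ltW.
Qed.

Lemma nonincreasing_is_derive f g a b : (forall x, is_derive x 1 f (g x)) ->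
  (forall x, a < x < b -> g x <= 0) -> a <= b -> f b <= f a.
Proof.
move=> df g0 ab; rewrite -lerN2.
apply: (@nondecreasing_is_derive (fun x => - f x) (fun x => - g x)) => //.
by move=> x /g0; rewrite oppr_ge0.
Qed.

End Derivatives.

(** * Hyperbolic functions *)

Section Hyperbolic.
Variable R : realType.
Implicit Types x y z c t : R.

Definition cosh x : R := (expR x + expR (- x)) / 2.
Definition sinh x : R := (expR x - expR (- x)) / 2.

Lemma cosh_gt0 x : 0 < cosh x.
Proof. by rewrite divr_gt0// addr_gt0// expR_gt0. Qed.

Lemma cosh0 : cosh 0 = 1.
Proof. by rewrite /cosh oppr0 expR0 divff. Qed.

Lemma sinh0 : sinh 0 = 0.
Proof. by rewrite /sinh oppr0 subrr mul0r. Qed.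

Lemma coshN x : cosh (- x) = cosh x.
Proof. by rewrite /cosh opprK addrC. Qed.

Lemma sinhN x : sinh (- x) = - sinh x.
Proof. by rewrite /sinh opprK -mulNr opprB. Qed.

Lemma sinh_ge0 x : 0 <= x -> 0 <= sinh x.
Proof. by move=> x0; rewrite divr_ge0// subr_ge0 ler_expR; lra. Qed.

Lemma sinhD x y : sinh (x + y) = sinh x * cosh y + cosh x * sinh y.
Proof. by rewrite /sinh /cosh opprD !expRD; field. Qed.

Lemma is_derive_expRN x : is_derive x 1 (fun t => expR (- t)) (- expR (- x)).
Proof.
have := is_derive_dilation (is_derive_expR (-1 * x)).
by under eq_fun do rewrite mulN1r; rewrite !mulN1r.
Qed.

Lemma is_derive_cosh x : is_derive x 1 cosh (sinh x).
Proof.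
have := is_derive_mul (is_derive_add (is_derive_expR x) (is_derive_expRN x))
  (is_derive_cst (2^-1 : R) x 1).
move=> /is_derive_eq; apply; rewrite /sinh /cst; ring.
Qed.

Lemma is_derive_sinh x : is_derive x 1 sinh (cosh x).
Proof.
have := is_derive_mul (is_derive_sub (is_derive_expR x) (is_derive_expRN x))
  (is_derive_cst (2^-1 : R) x 1).
move=> /is_derive_eq; apply; rewrite /cosh /cst; ring.
Qed.

Lemma sinh_gex x : 0 <= x -> x <= sinh x.
Proof.
move=> x0; rewrite -subr_ge0; pose F := fun t => sinh t - t.
have -> : 0 = F 0 by rewrite /F sinh0 subr0.
apply: (@nondecreasing_is_derive _ F (fun t => cosh t - 1)) => //.
  move=> t; exact: (is_derive_sub (is_derive_sinh t) (is_derive_id t (1 : R))).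
move=> t /andP[t0 _]; rewrite subr_ge0 /cosh.
have := expR_ge1Dx (R := R) t; have := expR_ge1Dx (- t); lra.
Qed.

Lemma sinh_le_xcosh x : 0 <= x -> sinh x <= x * cosh x.
Proof.
move=> x0; rewrite -subr_ge0; pose F := fun t => t * cosh t - sinh t.
have -> : 0 = F 0 by rewrite /F sinh0 mul0r subr0.
apply: (@nondecreasing_is_derive _ F (fun t => t * sinh t)) => //.
  move=> t; have := is_derive_sub (is_derive_mul (is_derive_id t (1 : R))
    (is_derive_cosh t)) (is_derive_sinh t).
  by move/is_derive_eq; apply; ring.
by move=> t /andP[t0 _]; rewrite mulr_ge0 ?sinh_ge0 ?ltW.
Qed.

(** The continuous extension of sinh x / x: its monotonicity gives the convexity
of the rate function. *)
Definition sinhc x : R := if x == 0 then 1 else sinh x / x.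

Lemma mul_sinhc x : x * sinhc x = sinh x.
Proof.
rewrite /sinhc; case: eqVneq => [->|x0]; first by rewrite mul0r sinh0.
by rewrite mulrC divfK.
Qed.

Lemma sinhcN x : sinhc (- x) = sinhc x.
Proof. by rewrite /sinhc oppr_eq0 sinhN invrN mulrNN. Qed.

Lemma sinhc_norm x : sinhc `|x| = sinhc x.
Proof. by case: ger0P => _ //; rewrite sinhcN. Qed.

Lemma sinhc_ge1 x : 1 <= sinhc x.
Proof.
rewrite -sinhc_norm; move: (normr_ge0 x); move: `|x| => y y0.
rewrite /sinhc; case: eqVneq => // yn0.
by rewrite ler_pdivlMr ?mul1r ?sinh_gex// lt_neqAle eq_sym yn0.
Qed.

(** For fixed x, the derivative x cosh t - sinh x of x sinh t - t sinh x is
nonnegative for t >= x because sinh x <= x cosh x. *)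
Lemma sinhc_nondecreasing x z : 0 <= x -> x <= z -> sinhc x <= sinhc z.
Proof.
rewrite le_eqVlt => /orP[/eqP<- _|x0 xz].
  by rewrite {1}/sinhc eqxx sinhc_ge1.
have z0 := lt_le_trans x0 xz.
rewrite /sinhc !gt_eqF// ler_pdivrMr// mulrAC ler_pdivlMr// [_ * z]mulrC.
rewrite mulrC [leRHS]mulrC -subr_ge0; pose F := fun t => x * sinh t - sinh x * t.
have -> : 0 = F x by rewrite /F mulrC subrr.
apply: (le_trans (y := F z)); last by rewrite /F; lra.
apply: (@nondecreasing_is_derive _ F (fun t => x * cosh t - sinh x)) => //.
  move=> t; have := is_derive_sub (is_derive_scale x (is_derive_sinh t))
    (is_derive_scale (sinh x) (is_derive_id t (1 : R))).
  by move/is_derive_eq; apply; ring.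
move=> t /andP[xt _]; rewrite subr_ge0 (le_trans (sinh_le_xcosh (ltW x0)))//.
apply: ler_wpM2l; first exact: ltW.
apply: (@nondecreasing_is_derive _ cosh sinh); last exact: ltW.
  exact: is_derive_cosh.
by move=> w /andP[xw _]; rewrite sinh_ge0// ltW// (lt_trans x0).
Qed.

Lemma sinhc_dilation_nondecreasing c x z : 0 <= x -> x <= z ->
  sinhc (c * x) <= sinhc (c * z).
Proof.
move=> x0 xz; rewrite -sinhc_norm -[leRHS]sinhc_norm !normrM.
rewrite (ger0_norm x0) (ger0_norm (le_trans x0 xz)).
by apply: sinhc_nondecreasing; rewrite ?mulr_ge0// ler_wpM2l.
Qed.

End Hyperbolic.

(** * Entropy and energy of a two-point distribution *)

Section Profiles.
Variable R : realType.
Implicit Types p c s t u v x y : R.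

Lemma cosh2_gt0 t : 0 < 2 * cosh t.
Proof. by rewrite mulr_gt0 ?cosh_gt0. Qed.

Lemma cosh_sinh_sqr t : cosh t ^+ 2 - sinh t ^+ 2 = 1.
Proof.
have := expRxMexpNx_1 t; rewrite /cosh /sinh.
move: (expR t) (expR (- t)) => e f ef.
by transitivity (e * f) => //; field.
Qed.

Lemma cosh_sinh_dilation c t :
  cosh (c * t) * sinh t - c * sinh (c * t) * cosh t =
  ((1 - c) * sinh ((1 + c) * t) + (1 + c) * sinh ((1 - c) * t)) / 2.
Proof.
rewrite !mulrDl !mul1r !mulNr !sinhD coshN sinhN; by field.
Qed.

(** This is ln 2 - h(y) for y = 1 / (1 + e^(2t)), see [binent_bias]. *)
Definition entropy_profile t : R := t * sinh t / cosh t - ln (cosh t).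

(** This is the formula for b_p at y = 1 / (1 + e^(2t)), see [b_formula_bias]. *)
Definition energy_profile p t : R :=
  Num.sg (p - 1) / 2 * (1 - cosh ((2 / p - 1) * t) / cosh t).

(** The derivative of the energy with respect to the entropy.  Unlike that
quotient of derivatives, this form makes sense at t = 0 and shows that it is
monotone. *)
Definition slope p t : R :=
  `|p - 1| / p ^+ 2 * (sinhc (2 / p * t) + sinhc ((2 - 2 / p) * t)).

Lemma is_derive_cosh_inv t :
  is_derive t 1 (fun x => (cosh x)^-1) (- (sinh t / cosh t ^+ 2)).
Proof.
have ch0 : cosh t != 0 by rewrite gt_eqF ?cosh_gt0.
have := is_deriveV ch0 (is_derive_cosh t).
move=> /is_derive_eq; apply.
by transitivity (- cosh t ^- 2 * sinh t) => //; rewrite mulNr mulrC.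
Qed.

Lemma is_derive_entropy_profile t :
  is_derive t 1 entropy_profile (t / cosh t ^+ 2).
Proof.
have ch0 : cosh t != 0 by rewrite gt_eqF ?cosh_gt0.
have dln : is_derive t 1 (fun x => ln (cosh x)) ((cosh t)^-1 * sinh t).
  exact: (is_derive1_comp (is_derive1_ln (cosh_gt0 t)) (is_derive_cosh t)).
have := is_derive_sub (is_derive_mul (is_derive_mul (is_derive_id t (1 : R))
  (is_derive_sinh t)) (is_derive_cosh_inv t)) dln.
move=> /is_derive_eq; apply.
have -> : t / cosh t ^+ 2 = t * (cosh t ^+ 2 - sinh t ^+ 2) / cosh t ^+ 2.
  by rewrite cosh_sinh_sqr mulr1.
by field.
Qed.

(** With c = 2/p - 1, the numerator of the derivative of - cosh(ct) / cosh t is a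
combination of sinh((1 + c)t) and sinh((1 - c)t); the common factor
(1 + c)(1 - c) = 4 (p - 1) / p^2 has the sign of p - 1. *)
Lemma is_derive_energy_profile p t : p != 0 ->
  is_derive t 1 (energy_profile p) (t / cosh t ^+ 2 * slope p t).
Proof.
move=> p0; have ch0 : cosh t != 0 by rewrite gt_eqF ?cosh_gt0.
pose c := 2 / p - 1.
have := is_derive_scale (Num.sg (p - 1) / 2) (is_derive_sub
  (is_derive_cst (1 : R) t 1) (is_derive_mul
    (is_derive_dilation (is_derive_cosh (c * t))) (is_derive_cosh_inv t))).
move=> /is_derive_eq; apply.
have -> : slope p t = Num.sg (p - 1) * (p - 1) / p ^+ 2 *
    (sinhc (2 / p * t) + sinhc ((2 - 2 / p) * t)) by rewrite -normrEsg.
have dil := cosh_sinh_dilation c t.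
rewrite -!mul_sinhc in dil.
have e1 : 1 + c = 2 / p by rewrite /c; ring.
have e2 : 1 - c = 2 - 2 / p by rewrite /c; ring.
rewrite e1 e2 !mul_sinhc in dil.
transitivity (Num.sg (p - 1) / 2 *
  ((cosh (c * t) * sinh t - c * sinh (c * t) * cosh t) / cosh t ^+ 2)).
  by field.
rewrite dil -[sinh (2 / p * t)]mul_sinhc -[sinh (_ * t)]mul_sinhc.
by field; rewrite p0.
Qed.

Lemma slope_gt0 p t : p != 0 -> p != 1 -> 0 < slope p t.
Proof.
move=> p0 p1; rewrite mulr_gt0//.
  by rewrite divr_gt0 ?normr_gt0 ?subr_eq0// exprn_even_gt0.
have := sinhc_ge1 (2 / p * t); have := sinhc_ge1 ((2 - 2 / p) * t); lra.
Qed.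

Lemma slope_nondecreasing p s t : 0 <= s -> s <= t -> slope p s <= slope p t.
Proof.
move=> s0 st; rewrite ler_wpM2l//.
  by rewrite divr_ge0 ?exprn_even_ge0.
by rewrite lerD// sinhc_dilation_nondecreasing.
Qed.

(** The difference of the two sides, as a function of t, has derivative
t / cosh^2 t (slope t - slope s), so its minimum is at t = s. *)
Lemma energy_profile_tangent p s t : p != 0 -> 0 <= s -> 0 <= t ->
  energy_profile p s + slope p s * (entropy_profile t - entropy_profile s)
  <= energy_profile p t.
Proof.
move=> p0 s0 t0.
pose F x := energy_profile p x - slope p s * entropy_profile x.
suff : F s <= F t by rewrite /F; lra.
pose G x := x / cosh x ^+ 2 * (slope p x - slope p s).
have dF x : is_derive x 1 F (G x).
  have := is_derive_sub (is_derive_energy_profile x p0)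
    (is_derive_scale (slope p s) (is_derive_entropy_profile x)).
  by move=> /is_derive_eq; apply; rewrite /G; ring.
have [st|ts] := lerP s t.
  apply: (nondecreasing_is_derive dF) => // x /andP[sx _].
  have x0 := le_lt_trans s0 sx.
  rewrite /G mulr_ge0 ?divr_ge0 ?exprn_ge0 ?(ltW x0) ?(ltW (cosh_gt0 _))//.
  by rewrite subr_ge0 slope_nondecreasing// ltW.
apply: (nonincreasing_is_derive dF); last exact: ltW.
move=> x /andP[tx xs]; have x0 := le_lt_trans t0 tx.
rewrite /G mulr_ge0_le0 ?divr_ge0 ?exprn_ge0 ?(ltW x0) ?(ltW (cosh_gt0 _))//.
by rewrite subr_le0 slope_nondecreasing// ltW.
Qed.

Lemma entropy_profile0 : entropy_profile 0 = 0.
Proof. by rewrite /entropy_profile !mul0r cosh0 ln1 subrr. Qed.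

Lemma energy_profile0 p : energy_profile p 0 = 0.
Proof. by rewrite /energy_profile mulr0 cosh0 divr1 subrr mulr0. Qed.

Lemma entropy_profileN t : entropy_profile (- t) = entropy_profile t.
Proof. by rewrite /entropy_profile sinhN coshN mulrNN. Qed.

Lemma energy_profileN p t : energy_profile p (- t) = energy_profile p t.
Proof. by rewrite /energy_profile mulrN !coshN. Qed.

Lemma entropy_profile_lt s t : 0 <= s -> s < t ->
  entropy_profile s < entropy_profile t.
Proof.
move=> s0; apply: (increasing_is_derive is_derive_entropy_profile).
move=> x /andP[sx _].
by rewrite divr_gt0 ?exprn_gt0 ?cosh_gt0// (le_lt_trans s0).
Qed.

Lemma entropy_profile_ge0 t : 0 <= t -> 0 <= entropy_profile t.
Proof.
rewrite le_eqVlt => /orP[/eqP <-|t0]; first by rewrite entropy_profile0.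
by rewrite -entropy_profile0 ltW// entropy_profile_lt.
Qed.

Lemma entropy_profile_inj s t : 0 <= s -> 0 <= t ->
  entropy_profile s = entropy_profile t -> s = t.
Proof.
move=> s0 t0 e; case: (ltgtP s t) => // [st|ts].
  by have := entropy_profile_lt s0 st; rewrite e ltxx.
by have := entropy_profile_lt t0 ts; rewrite e ltxx.
Qed.

Lemma entropy_profile_gap t : ln 2 - entropy_profile t =
  t * expR (- t) / cosh t + ln (1 + expR (- (2 * t))).
Proof.
have -> : 1 + expR (- (2 * t)) = 2 * cosh t * expR (- t).
  have -> : - (2 * t) = - t + - t by ring.
  rewrite expRD -{1}(expRxMexpNx_1 t) /cosh; by field.
rewrite lnM ?posrE ?expR_gt0 ?cosh2_gt0//.
rewrite lnM ?posrE ?cosh_gt0// expRK /entropy_profile.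
have -> : expR (- t) = cosh t - sinh t by rewrite /cosh /sinh; field.
by field; rewrite gt_eqF ?cosh_gt0.
Qed.

Lemma entropy_profile_lt_ln2 t : entropy_profile t < ln 2.
Proof.
wlog t0 : t / 0 <= t.
  move=> H; case: (lerP 0 t) => [/H//|t0].
  by rewrite -entropy_profileN H// oppr_ge0 ltW.
rewrite -subr_gt0 entropy_profile_gap ltr_wpDl//.
  by rewrite divr_ge0 ?mulr_ge0 ?expR_ge0 ?(ltW (cosh_gt0 _)).
by rewrite ln_gt0// ltrDl expR_gt0.
Qed.

Lemma expRN_le t : 0 <= t -> expR (- t) <= (1 + t)^-1.
Proof.
move=> t0; rewrite expRN lef_pV2 ?posrE ?expR_gt0 ?expR_ge1Dx//.
lra.
Qed.

Lemma expR_le2cosh t : expR t <= 2 * cosh t.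
Proof. by rewrite /cosh; have := expR_gt0 (- t); lra. Qed.

(** The gap is of order t e^(-2t); the crude rational bound is enough to show that
it vanishes at infinity, by [vanishing_bound]. *)
Lemma entropy_profile_gap_le t : 0 <= t ->
  ln 2 - entropy_profile t <= 2 / (1 + t).
Proof.
move=> t0; rewrite entropy_profile_gap.
pose q := expR (- t); have q0 : 0 < q by exact: expR_gt0.
have lnq : ln (1 + expR (- (2 * t))) <= q ^+ 2.
  rewrite (le_trans (le_ln1Dx _)) ?(lt_trans _ (expR_gt0 _))//.
  by rewrite -expRM_natl mulrN.
have chq : t * q / cosh t <= 2 * t * q ^+ 2.
  rewrite ler_pdivrMr ?cosh_gt0//.
  have : q * expR t <= q * (2 * cosh t) by rewrite ler_wpM2l ?expR_le2cosh// ltW.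
  rewrite /q [_ * expR t]mulrC expRxMexpNx_1 -/q => h.
  have tq : 0 <= t * q by rewrite mulr_ge0// ltW.
  have : 0 <= t * q * (q * (2 * cosh t) - 1) by rewrite mulr_ge0// subr_ge0.
  lra.
have t1 : 0 < 1 + t by lra.
rewrite (le_trans (lerD chq lnq))// ler_pdivlMr//.
have h : (1 + t) * q <= 1.
  by rewrite mulrC -ler_pdivlMr// mul1r expRN_le.
have h' : 0 <= (1 + t) * q by rewrite mulr_ge0 ?ltW.
have : ((1 + t) * q) * ((1 + t) * q) <= 1 * 1 by rewrite ler_pM.
have : 0 <= q ^+ 2 by rewrite exprn_ge0// ltW.
nra.
Qed.

Lemma vanishing_bound (x C : R) :
  (forall t, 0 <= t -> x <= C / (1 + t)) -> x <= 0.
Proof.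
move=> H; rewrite leNgt; apply/negP => x0.
have /H : 0 <= `|C| / x by rewrite divr_ge0// ltW.
have n0 := normr_ge0 C.
have d0 : 0 < 1 + `|C| / x by rewrite ltr_pwDl// divr_ge0// ltW.
rewrite ler_pdivlMr// mulrDr mulr1 mulrCA divff ?gt_eqF// mulr1.
have := ler_norm C; lra.
Qed.

(** For p > 1 one has |c| < 1 with c = 2/p - 1, so that cosh(ct) / cosh t decays
like e^(-(1 - |c|)t). *)
Lemma energy_profile_gap_le p t : 1 < p -> 0 <= t ->
  2^-1 - energy_profile p t <= (1 - `|2 / p - 1|)^-1 / (1 + t).
Proof.
move=> p1 t0; have p0 : 0 < p by lra.
pose c := 2 / p - 1; pose d := 1 - `|c|.
have c1 : `|c| < 1.
  have : 0 < p^-1 by rewrite invr_gt0.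
  have : p^-1 < 1 by rewrite invf_lt1.
  by rewrite /c; move=> ? ?; rewrite ltr_norml; apply/andP; split; lra.
have d0 : 0 < d by rewrite subr_gt0.
rewrite /energy_profile gtr0_sg ?subr_gt0// -/c -/d.
have -> : 2^-1 - 1 / 2 * (1 - cosh (c * t) / cosh t) =
          cosh (c * t) / (2 * cosh t).
  by field; rewrite gt_eqF ?cosh_gt0.
have cht : cosh (c * t) <= expR (`|c| * t).
  rewrite /cosh ler_pdivrMr// mulr_natr mulr2n lerD// ler_expR.
    by rewrite ler_wpM2r ?ler_norm.
  by rewrite -mulNr ler_wpM2r// -normrN ler_norm.
apply: (@le_trans _ _ (expR (- (d * t)))).
  have -> : expR (- (d * t)) = expR (`|c| * t) / expR t.
    by rewrite -expRN -expRD /d; congr expR; ring.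
  rewrite ler_pM ?invr_ge0 ?(ltW (cosh2_gt0 _)) ?(ltW (cosh_gt0 _))//.
  by rewrite lef_pV2 ?posrE ?cosh2_gt0 ?expR_gt0 ?expR_le2cosh.
have dt0 : 0 <= d * t by rewrite mulr_ge0// ltW.
apply: (le_trans (expRN_le dt0)).
have [t1 dt1] : 0 < 1 + t /\ 0 < 1 + d * t by nra.
rewrite -invfM lef_pV2 ?posrE ?mulr_gt0//.
have := normr_ge0 c; rewrite /d; lra.
Qed.

Lemma entropy_profile_surj u : 0 <= u < ln 2 ->
  exists2 t, 0 <= t & entropy_profile t = u.
Proof.
move=> /andP[u0 u2].
have [t t0 ut] : exists2 t, 0 <= t & u <= entropy_profile t.
  apply: contrapT => H.
  suff : ln 2 - u <= 0 by lra.
  apply: (@vanishing_bound _ 2) => t t0.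
  apply: le_trans (entropy_profile_gap_le t0).
  rewrite lerB// leNgt; apply/negP => h; apply: H; exists t => //; exact: ltW.
have [|x] := IVT t0 (is_derive_within (a := 0) (b := t)
    is_derive_entropy_profile) (v := u).
  by rewrite entropy_profile0 ge_min le_max u0 ut orbT.
by rewrite in_itv/= => /andP[x0 _] <-; exists x.
Qed.

(** * The logistic parametrization *)

(** This is 1 / (1 + e^(2t)), in a form in which replacing t by - t visibly gives
the complementary probability. *)
Definition bias t : R := expR (- t) / (2 * cosh t).

Lemma bias_gt0 t : 0 < bias t.
Proof. by rewrite divr_gt0 ?expR_gt0 ?cosh2_gt0. Qed.

Lemma onem_bias t : 1 - bias t = bias (- t).
Proof.
rewrite /bias coshN opprK -{1}(@divff _ (2 * cosh t)); last first.
  by rewrite gt_eqF ?cosh2_gt0.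
by rewrite -mulrBl; congr (_ / _); rewrite /cosh; field.
Qed.

Lemma bias_le_half t : 0 <= t -> bias t <= 2^-1.
Proof.
move=> t0; rewrite /bias ler_pdivrMr ?cosh2_gt0// mulKf//.
rewrite /cosh ler_pdivlMr// mulr_natr mulr2n lerD2r ler_expR; lra.
Qed.

Lemma bias_surj y : 0 < y <= 2^-1 -> exists2 t, 0 <= t & bias t = y.
Proof.
move=> /andP[y0 y2]; have y1 : 0 < 1 - y by lra.
pose t := (ln (1 - y) - ln y) / 2; exists t.
  by rewrite divr_ge0// subr_ge0 ler_ln ?posrE//; lra.
have et : expR t ^+ 2 = (1 - y) / y.
  rewrite -expRM_natl /t mulrCA divff// mulr1 expRB !lnK//.
rewrite /bias /cosh [2 * _]mulrCA divff// mulr1 expRN.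
have e0 := expR_gt0 t.
have -> : (expR t)^-1 / (expR t + (expR t)^-1) = (expR t ^+ 2 + 1)^-1.
  by field; rewrite gt_eqF//= gt_eqF// addr_gt0 ?exprn_gt0.
by rewrite et -{2}(@divff _ y) ?gt_eqF// -mulrDl subrK div1r invrK.
Qed.

Lemma ln_bias t : ln (bias t) = - t - ln (2 * cosh t).
Proof.
by rewrite /bias ln_div ?posrE ?expR_gt0 ?cosh2_gt0// expRK.
Qed.

Lemma binent_bias t : ln 2 - binent (bias t) = entropy_profile t.
Proof.
have ch0 := cosh_gt0 t.
rewrite /binent onem_bias !ln_bias coshN lnM ?posrE//.
rewrite /bias coshN opprK /entropy_profile.
have -> : expR (- t) = cosh t - sinh t by rewrite /cosh /sinh; field.
have -> : expR t = cosh t + sinh t by rewrite /cosh /sinh; field.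
by field; rewrite gt_eqF.
Qed.

Lemma b_formula_bias p t : p != 0 -> b_formula p (bias t) = energy_profile p t.
Proof.
move=> p0; have ch0 := cosh_gt0 t.
rewrite /b_formula onem_bias /powR !gt_eqF ?bias_gt0// -!expRD !ln_bias coshN.
rewrite /energy_profile -addrA -opprD; congr (_ * (1 - _)).
have -> : p^-1 * (- t - ln (2 * cosh t)) +
    (1 - p^-1) * (- - t - ln (2 * cosh t)) =
    - ((2 / p - 1) * t) - ln (2 * cosh t) by field.
have -> : (1 - p^-1) * (- t - ln (2 * cosh t)) +
    p^-1 * (- - t - ln (2 * cosh t)) =
    (2 / p - 1) * t - ln (2 * cosh t) by field.
rewrite !expRB lnK ?posrE ?cosh2_gt0//.
set x := (_ * t); rewrite {3}/cosh.
by field; rewrite gt_eqF.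
Qed.

Lemma range_entropy :
  [set ln 2 - binent y | y in `]0, 2^-1]] = `[0, ln 2[%classic :> set R.
Proof.
apply/seteqP; split => [u|u]; rewrite /= in_itv/=.
  move=> [y]; rewrite in_itv/= => /bias_surj[t t0 <-] <-.
  rewrite binent_bias entropy_profile_lt_ln2 andbT.
  exact: entropy_profile_ge0.
move=> /entropy_profile_surj[t t0 <-]; exists (bias t); last exact: binent_bias.
by rewrite in_itv/= bias_gt0 bias_le_half.
Qed.

End Profiles.

(** * The rate function and its supporting lines *)

Section Rate.
Variables (R : realType) (p : R).
Hypotheses (p_neq0 : p != 0) (p_neq1 : p != 1).
Implicit Types a b k s t u v x y : R.

(** The line u |-> k + s u lies below the curve (entropy, energy). *)
Definition minorant k s :=
  forall t, 0 <= t -> k + s * entropy_profile t <= energy_profile p t.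

Lemma minorantE k s t : minorant k s ->
  k + s * entropy_profile t <= energy_profile p t.
Proof.
move=> H; case: (lerP 0 t) => [/H//|t0].
by rewrite -entropy_profileN -energy_profileN H// oppr_ge0 ltW.
Qed.

Lemma tangent_minorant s : 0 <= s ->
  minorant (energy_profile p s - slope p s * entropy_profile s) (slope p s).
Proof.
by move=> s0 t t0; have := energy_profile_tangent p_neq0 s0 t0; lra.
Qed.

Lemma energy_profile_lt_half t : 1 < p -> energy_profile p t < 2^-1.
Proof.
move=> p1; rewrite /energy_profile gtr0_sg ?subr_gt0//.
have : 0 < cosh ((2 / p - 1) * t) / cosh t by rewrite divr_gt0 ?cosh_gt0.
lra.
Qed.

Lemma minorant_ln2 k s : 1 < p -> 0 <= s -> minorant k s -> k + s * ln 2 <= 2^-1.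
Proof.
move=> p1 s0 H; rewrite -subr_le0; apply: (@vanishing_bound _ _ (s * 2)) => t t0.
have := H t t0; have := energy_profile_lt_half t p1.
have : s * (ln 2 - entropy_profile t) <= s * (2 / (1 + t)).
  by apply: ler_wpM2l => //; exact: entropy_profile_gap_le.
lra.
Qed.

(** The energy as a function of the entropy.  The entropy profile is injective on
t >= 0, so the choice made by [xget] is forced on [0, ln 2[. *)
Definition rate u : R := if u == ln 2 then 2^-1
  else energy_profile p (xget 0 [set t | 0 <= t /\ entropy_profile t = u]).

Lemma rate_profile t : 0 <= t -> rate (entropy_profile t) = energy_profile p t.
Proof.
move=> t0; rewrite /rate lt_eqF ?entropy_profile_lt_ln2//.
case: xgetP => [x _ [x0 xt]|/(_ t) H]; last by case: H.
by rewrite (entropy_profile_inj x0 t0).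
Qed.

Lemma rate_ln2 : rate (ln 2) = 2^-1.
Proof. by rewrite /rate eqxx. Qed.

Lemma b_dom_cases v : v \in b_dom p ->
  (exists2 t, 0 <= t & v = entropy_profile t) \/ (1 < p /\ v = ln 2).
Proof.
rewrite /b_dom; case: ifPn => p1; rewrite in_itv/= => /andP[v0].
  rewrite le_eqVlt => /orP[/eqP ->|v2]; first by right.
  by have [|t t0 <-] := @entropy_profile_surj _ v; [rewrite v0|left; exists t].
move=> v2.
by have [|t t0 <-] := @entropy_profile_surj _ v; [rewrite v0|left; exists t].
Qed.

Lemma minorant_rate k s v : 0 <= s -> minorant k s -> v \in b_dom p ->
  k + s * v <= rate v.
Proof.
move=> s0 H /b_dom_cases[[t t0 ->]|[p1 ->]]; first by rewrite rate_profile// H.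
by rewrite rate_ln2 minorant_ln2.
Qed.

Lemma tangent_rate t v : 0 <= t -> v \in b_dom p ->
  energy_profile p t + slope p t * (v - entropy_profile t) <= rate v.
Proof.
move=> t0 vd.
have := minorant_rate (ltW (slope_gt0 t p_neq0 p_neq1)) (tangent_minorant t0) vd.
lra.
Qed.

Lemma rate_ge0 : {in b_dom p, forall u, 0 <= rate u}.
Proof.
move=> u ud; have := tangent_rate (lexx 0) ud.
rewrite energy_profile0 entropy_profile0 add0r subr0; apply: le_trans.
rewrite mulr_ge0 ?(ltW (slope_gt0 _ _ _))//.
by move: ud; rewrite /b_dom; case: ifP => _; rewrite in_itv/= => /andP[].
Qed.

Lemma b_dom_le_ln2 u : u \in b_dom p -> u <= ln 2.
Proof.
by rewrite /b_dom; case: ifP => _; rewrite in_itv/= => /andP[_ //]; exact: ltW.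
Qed.

Lemma rate_lt : {in b_dom p &, {homo rate : u v / u < v}}.
Proof.
move=> u v /b_dom_cases[[t t0 ->]|[_ ->]] vd uv; last first.
  by have := b_dom_le_ln2 vd; rewrite leNgt uv.
rewrite rate_profile//; have := tangent_rate t0 vd; apply: lt_le_trans.
by rewrite ltrDl mulr_gt0 ?slope_gt0// subr_gt0.
Qed.

Lemma b_dom_conv (w u v : R) : 0 <= w <= 1 -> u \in b_dom p -> v \in b_dom p ->
  w * u + (1 - w) * v \in b_dom p.
Proof.
move=> /andP[w0 w1] ud vd.
have [ge0 le_max] : 0 <= w * u + (1 - w) * v /\
    w * u + (1 - w) * v <= Num.max u v.
  have w1' : 0 <= 1 - w by rewrite subr_ge0.
  have dom_ge0 x : x \in b_dom p -> 0 <= x.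
    by rewrite /b_dom; case: ifP => _; rewrite in_itv/= => /andP[].
  split; first by rewrite addr_ge0// mulr_ge0// dom_ge0.
  have : w * u <= w * Num.max u v by rewrite ler_wpM2l// le_max lexx.
  have : (1 - w) * v <= (1 - w) * Num.max u v.
    by rewrite ler_wpM2l// le_max lexx orbT.
  lra.
move: ud vd; rewrite /b_dom; case: ifPn => p1;
  rewrite !in_itv/= ge0 => /andP[_ u2] /andP[_ v2] /=.
  by rewrite (le_trans le_max)// ge_max u2.
by rewrite (le_lt_trans le_max)// gt_max u2.
Qed.

(** At an interior point, the tangent line there lies below the graph at both ends
of the chord; the point ln 2 is an extreme point of the domain. *)
Lemma rate_convex : convex_function (E := R^o) [set` b_dom p] rate.
Proof.
move=> w u v; rewrite !inE /= => ud vd.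
have convE (x y : R^o) : conv w x y = w%:num * x + (1 - w%:num) * y by [].
rewrite convE [X in rate X]convE.
have w01 : 0 <= w%:num <= 1 by apply/andP; split.
move: (w%:num) w01 => {convE}{}w w01; have /andP[w0 w1] := w01.
have [[t t0 ut]|[p1 e]] := b_dom_cases (b_dom_conv w01 ud vd).
  rewrite ut rate_profile//.
  have := ler_wpM2l w0 (tangent_rate t0 ud).
  have w1' : 0 <= 1 - w by rewrite subr_ge0.
  have := ler_wpM2l w1' (tangent_rate t0 vd).
  by rewrite -ut; move: (slope p t) => s; lra.
rewrite e rate_ln2.
have ud2 := b_dom_le_ln2 ud; have vd2 := b_dom_le_ln2 vd.
(* If 0 < w < 1, both u and v must be the maximum ln 2. *)
have [w00|wn0] := eqVneq w 0.
  have -> : v = ln 2 by move: e; rewrite w00; lra.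
  rewrite w00 rate_ln2; lra.
have [w11|wn1] := eqVneq w 1.
  have -> : u = ln 2 by move: e; rewrite w11; lra.
  rewrite w11 rate_ln2; lra.
have w0' : 0 < w by rewrite lt_neqAle eq_sym wn0.
have w1' : w < 1 by rewrite lt_neqAle wn1.
have -> : u = ln 2 by nra.
have -> : v = ln 2 by nra.
by rewrite rate_ln2; lra.
Qed.

Lemma rate_le_half u : 1 < p -> u \in b_dom p -> rate u <= 2^-1.
Proof.
move=> p1 /b_dom_cases[[t t0 ->]|[_ ->]]; last by rewrite rate_ln2.
by rewrite rate_profile// ltW// energy_profile_lt_half.
Qed.

Lemma rate_cvg_ln2 : 1 < p -> rate u @[u --> (ln 2)^'-] --> rate (ln 2).
Proof.
move=> p1; rewrite rate_ln2; apply/cvgrPdist_lt => e e0.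
have [t t0 te] : exists2 t, 0 <= t & 2^-1 - energy_profile p t < e.
  apply: contrapT => H.
  suff : e <= 0 by rewrite leNgt e0.
  apply: (@vanishing_bound _ _ (1 - `|2 / p - 1|)^-1) => t t0.
  apply: le_trans (energy_profile_gap_le p1 t0).
  by rewrite leNgt; apply/negP => h; apply: H; exists t.
near=> u.
have tu : entropy_profile t < u.
  by near: u; apply: nbhs_left_gt; exact: entropy_profile_lt_ln2.
have u2 : u < ln 2 by near: u; exact: nbhs_left_lt.
have tdom x : entropy_profile t <= x -> x < ln 2 -> x \in b_dom p.
  move=> tx x2; rewrite /b_dom p1 in_itv/= (ltW x2) andbT.
  by rewrite (le_trans (entropy_profile_ge0 t0)).
have ud : u \in b_dom p by rewrite tdom// ltW.
have td : entropy_profile t \in b_dom p by rewrite tdom// entropy_profile_lt_ln2.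
have := rate_lt td ud tu; have := rate_le_half p1 ud; rewrite rate_profile//.
by move=> ? ?; rewrite ger0_norm; lra.
Unshelve. all: by end_near.
Qed.

(** A two-point distribution concentrated on one point has normalized entropy ln 2
and normalized energy 1/2. *)
Lemma two_point_zero k s x : 1 < p -> 0 <= s -> minorant k s -> 0 <= x ->
  x `^ p / 2 * k + s * (x `^ p * ln (x `^ p / (x `^ p / 2)) / 2) <=
  x * x `^ (p - 1) / 4.
Proof.
move=> p1 s0 H; rewrite le_eqVlt => /orP[/eqP <-|x0].
  by rewrite powR0// !mul0r mulr0 addr0.
have xp := powR_gt0 p x0.
have -> : x * x `^ (p - 1) = x `^ p.
  by rewrite mulr_powRB1 ?(ltW x0)//; lra.
have -> : x `^ p / (x `^ p / 2) = 2 by field; rewrite gt_eqF.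
have := ler_wpM2l (ltW xp) (minorant_ln2 p1 s0 H); lra.
Qed.

(** For a, b > 0, write a = e^(mu + d) and b = e^(mu - d).  With t = pd, the mean m
is e^(p mu) cosh t, the entropy is m U(t) and the right-hand side is m B(t), so
that the claim is the hypothesis on the line at t. *)
Lemma two_point k s a b : 0 <= s -> minorant k s -> 0 <= a -> 0 <= b ->
  (p < 1 -> 0 < a /\ 0 < b) ->
  let m := (a `^ p + b `^ p) / 2 in
  m * k + s * ((a `^ p * ln (a `^ p / m) + b `^ p * ln (b `^ p / m)) / 2) <=
  Num.sg (p - 1) * ((a - b) * (a `^ (p - 1) - b `^ (p - 1)) / 4).
Proof.
move=> s0 H a0 b0 ab /=.
have p1n0 : p - 1 != 0 by rewrite subr_eq0.
have [a00|an0] := eqVneq a 0.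
  have p1 : 1 < p.
    by case: ltgtP p_neq1 => // /ab[]; rewrite a00 ltxx.
  rewrite a00 !powR0// !add0r mul0r add0r mulrNN gtr0_sg ?subr_gt0// mul1r.
  exact: two_point_zero.
have [b00|bn0] := eqVneq b 0.
  have p1 : 1 < p.
    by case: ltgtP p_neq1 => // /ab[]; rewrite b00 ltxx.
  rewrite b00 !powR0// !addr0 mul0r addr0 !subr0 gtr0_sg ?subr_gt0// mul1r.
  exact: two_point_zero.
have {a0 an0} a0 : 0 < a by rewrite lt_neqAle eq_sym an0.
have {b0 bn0} b0 : 0 < b by rewrite lt_neqAle eq_sym bn0.
clear ab.
pose mu := (ln a + ln b) / 2; pose d := (ln a - ln b) / 2.
have ea : a = expR (mu + d).
  by rewrite -[LHS]lnK ?posrE//; congr expR; rewrite /mu /d; field.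
have eb : b = expR (mu - d).
  by rewrite -[LHS]lnK ?posrE//; congr expR; rewrite /mu /d; field.
move: mu d ea eb => mu d -> -> {a b a0 b0}.
rewrite -!expRM.
have -> : (mu + d) * p = p * mu + p * d by ring.
have -> : (mu - d) * p = p * mu + - (p * d) by ring.
pose E := expR (p * mu); have E0 : 0 < E := expR_gt0 _.
pose t := p * d.
have ch0 := cosh_gt0 t.
rewrite !(expRD (p * mu)) -/E -/t.
have -> : (E * expR t + E * expR (- t)) / 2 = E * cosh t.
  by rewrite /cosh; field.
have lnt x : ln (E * expR x / (E * cosh t)) = x - ln (cosh t).
  have -> : E * expR x / (E * cosh t) = expR x / cosh t.
    by field; rewrite !gt_eqF.
  by rewrite ln_div ?posrE ?expR_gt0// expRK.
rewrite !lnt.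
have -> : (E * expR t * (t - ln (cosh t)) +
    E * expR (- t) * (- t - ln (cosh t))) / 2 = E * cosh t * entropy_profile t.
  rewrite /entropy_profile.
  have -> : E * cosh t * (t * sinh t / cosh t - ln (cosh t)) =
    E * (t * sinh t - cosh t * ln (cosh t)) by field; rewrite gt_eqF.
  by move: (ln _) => l; rewrite /sinh /cosh; field.
apply: (@le_trans _ _ (E * cosh t * energy_profile p t)).
  have Ec : 0 <= E * cosh t by rewrite mulr_ge0// ltW.
  by have := ler_wpM2l Ec (minorantE t H); lra.
rewrite /energy_profile le_eqVlt; apply/orP; left; apply/eqP.
have -> : (2 / p - 1) * t = (2 - p) * d by rewrite /t; field.
have -> : E * cosh t * (Num.sg (p - 1) / 2 *
    (1 - cosh ((2 - p) * d) / cosh t)) =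
  Num.sg (p - 1) * (E * (2 * cosh t - 2 * cosh ((2 - p) * d)) / 4).
  by field; rewrite gt_eqF.
congr (_ * (_ / _)).
rewrite [RHS]mulrBl [X in _ = X - _]mulrBr [X in _ = _ - X]mulrBr -!expRD.
rewrite /cosh.
have -> : mu + d + (mu + d) * (p - 1) = p * mu + t by rewrite /t; ring.
have -> : mu + d + (mu - d) * (p - 1) = p * mu + (2 - p) * d by ring.
have -> : mu - d + (mu + d) * (p - 1) = p * mu + - ((2 - p) * d) by ring.
have -> : mu - d + (mu - d) * (p - 1) = p * mu + - t by rewrite /t; ring.
by rewrite !(expRD (p * mu)) -/E; field.
Qed.

End Rate.

(** * Flipping a coordinate of the cube *)

Section Flip.
Variable n : nat.
Implicit Types (i j : 'I_n) (x y : cube n) (s : seq 'I_n).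

Definition flip i x : cube n := [ffun j => x j (+) (j == i)].

Lemma flipK i : involutive (flip i).
Proof. by move=> x; apply/ffunP => j; rewrite !ffunE addbK. Qed.

Lemma flipC i j x : flip i (flip j x) = flip j (flip i x).
Proof. by apply/ffunP => k; rewrite !ffunE addbAC. Qed.

Lemma flip_inj x : injective (flip ^~ x).
Proof.
move=> i j /ffunP/(_ i); rewrite !ffunE eqxx addbT.
by case: eqVneq => // _; case: (x i).
Qed.

Lemma adj_flip x y : adj y x = (y \in [set flip i x | i in [set: 'I_n]]%SET).
Proof.
apply/cards1P/imsetP => [[i yx]|[i _ ->]].
  exists i; rewrite ?inE//; apply/ffunP => j.
  have /setP/(_ j) := yx; rewrite !inE ffunE => <-.
  by case: (y j); case: (x j).
by exists i; apply/setP => j; rewrite !inE ffunE; case: (x j); case: (j == i).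
Qed.

Lemma foldr_flipE s x j : uniq s ->
  (foldr flip x s : cube n) j = x j (+) (j \in s).
Proof.
elim: s => [|i s IH] /= => [_|/andP[is_ us]]; first by rewrite addbF.
rewrite ffunE IH// in_cons; case: (eqVneq j i) => [->|_]; last by rewrite addbF.
by rewrite (negbTE is_) addbF.
Qed.

(** Any two points of the cube are related by flipping the coordinates at which
they differ. *)
Lemma flip_invariant_const (T : Type) (h : cube n -> T) :
  (forall i x, h (flip i x) = h x) -> forall x y, h x = h y.
Proof.
move=> hinv x y.
have -> : y = foldr flip x (enum [set j | x j != y j]%SET).
  apply/ffunP => j; rewrite foldr_flipE ?enum_uniq// mem_enum inE.
  by case: (x j); case: (y j).
by elim: (enum _) => //= i s ->; rewrite hinv.
Qed.

End Flip.

(** * Expectation, Dirichlet form and entropy on the cube *)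

Section Expectation.
Variables (R : realType) (n : nat).
Implicit Types (f g F G : cube n -> R) (i j : 'I_n) (x y : cube n).

Lemma card_cube_gt0 : 0 < #|cube n|%:R :> R.
Proof. by rewrite ltr0n card_ffun card_bool expn_gt0. Qed.

Lemma eq_expect f g : f =1 g -> expect f = expect g.
Proof. by move=> fg; congr (_ / _); apply: eq_bigr => x _. Qed.

Lemma expectD f g : expect (fun x => f x + g x) = expect f + expect g.
Proof. by rewrite /expect big_split mulrDl. Qed.

Lemma expectZ (k : R) f : expect (fun x => k * f x) = k * expect f.
Proof. by rewrite /expect -mulr_sumr mulrA. Qed.

Lemma expectB f g : expect (fun x => f x - g x) = expect f - expect g.
Proof. by rewrite /expect sumrB mulrBl. Qed.

Lemma expect_sum (I : Type) (s : seq I) (F : I -> cube n -> R) :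
  expect (fun x => \sum_(i <- s) F i x) = \sum_(i <- s) expect (F i).
Proof. by rewrite /expect exchange_big /= mulr_suml. Qed.

Lemma expect_cst (k : R) : expect (fun _ : cube n => k) = k.
Proof.
by rewrite /expect sumr_const -[k *+ _]mulr_natr mulfK// gt_eqF// card_cube_gt0.
Qed.

Lemma ler_expect f g : (forall x, f x <= g x) -> expect f <= expect g.
Proof.
move=> fg; rewrite ler_pM2r ?invr_gt0 ?card_cube_gt0//.
by apply: ler_sum => x _.
Qed.

Lemma ltr_expect f g : (forall x, f x < g x) -> expect f < expect g.
Proof.
move=> fg; rewrite ltr_pM2r ?invr_gt0 ?card_cube_gt0//.
apply: ltr_sum => //; apply/hasP; exists ([ffun => false] : cube n) => //.
Qed.

Lemma expect_flip i f : expect (fun x => f (flip i x)) = expect f.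
Proof.
by rewrite /expect [in RHS](reindex_inj (inv_inj (flipK i))).
Qed.

Lemma laplacian_flip f x : laplacian f x = \sum_i (f (flip i x) - f x).
Proof.
rewrite /laplacian (eq_bigl _ _ (fun y => adj_flip x y)).
rewrite big_imset => [|i j _ _]; last exact: flip_inj.
by apply: eq_bigl => i; rewrite inE.
Qed.

(** The flip preserves the uniform measure, so each direction may be symmetrized
over the two ends of an edge. *)
Lemma dirichlet_flip f g : dirichlet f g =
  \sum_i expect (fun x => (f x - f (flip i x)) * (g x - g (flip i x)) / 4).
Proof.
rewrite /dirichlet -expectZ.
rewrite (@eq_expect _ (fun x => \sum_i (2^-1 * (f x - f (flip i x)) * g x))).
  rewrite expect_sum; apply: eq_bigr => i _.
  pose F x := 2^-1 * (f x - f (flip i x)) * g x.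
  have -> : expect F = 2^-1 * (expect F + expect (fun x => F (flip i x))).
    by rewrite expect_flip; lra.
  by rewrite -expectD -expectZ; apply: eq_expect => x; rewrite /F flipK; field.
move=> x; rewrite laplacian_flip mulr_suml mulr_sumr.
by apply: eq_bigr => i _; ring.
Qed.

(** The conditional expectation of g given all coordinates but i. *)
Definition avg i g : cube n -> R := fun x => (g x + g (flip i x)) / 2.

Lemma avg_flip i g x : avg i g (flip i x) = avg i g x.
Proof. by rewrite /avg flipK addrC. Qed.

Lemma expect_avg i g : expect (avg i g) = expect g.
Proof.
rewrite /avg (@eq_expect _ (fun x => 2^-1 * (g x + g (flip i x)))).
  by rewrite expectZ expectD expect_flip; lra.
by move=> x; rewrite mulrC.
Qed.

Lemma avg_ge0 i g : (forall x, 0 <= g x) -> forall x, 0 <= avg i g x.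
Proof. by move=> g0 x; rewrite divr_ge0// addr_ge0. Qed.

Lemma avg_gt0 i g x : (forall x, 0 <= g x) -> 0 < g x -> 0 < avg i g x.
Proof. by move=> g0 gx; rewrite divr_gt0// ltr_pwDl. Qed.

(** The mean entropy of g on the edges in direction i, that is, the conditional
entropy given the other coordinates. *)
Definition cond_ent i g : R := expect (fun x => g x * ln (g x / avg i g x)).

Lemma cond_ent_flip i g : cond_ent i g =
  expect (fun x => (g x * ln (g x / avg i g x) +
    g (flip i x) * ln (g (flip i x) / avg i g x)) / 2).
Proof.
rewrite /cond_ent -(expect_avg i); apply: eq_expect => x.
by rewrite /avg flipK [g (flip i x) + g x]addrC.
Qed.

(** This is ln r <= r - 1 at r = cm / (ka), multiplied by a. *)
Lemma gibbs_term (a m c k : R) : 0 <= a -> 0 <= m -> 0 <= c -> 0 <= k ->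
  (0 < a -> [/\ 0 < m, 0 < c & 0 < k]) ->
  a * (ln c - ln k) - a * ln (a / m) <= c / k * m - a.
Proof.
rewrite le_eqVlt => /orP[/eqP <-|a0] m0 c0 k0 H.
  by rewrite !mul0r !subr0 mulr_ge0// divr_ge0.
have [{}m0 {}c0 {}k0] := H a0.
have r0 : 0 < c / k * m / a by rewrite !(divr_gt0, mulr_gt0).
have h : ln (c / k * m / a) <= c / k * m / a - 1.
  rewrite -[X in ln X](subrK 1) addrC le_ln1Dx//; lra.
have : a * ln (c / k * m / a) <= a * (c / k * m / a - 1).
  by apply: ler_wpM2l => //; exact: ltW.
have -> : a * (c / k * m / a - 1) = c / k * m - a by field; rewrite !gt_eqF.
apply: le_trans; rewrite -mulrBr le_eqVlt; apply/orP; left; apply/eqP.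
congr (_ * _).
rewrite !(ln_div, lnM) ?posrE ?divr_gt0 ?mulr_gt0 ?invr_gt0//.
ring.
Qed.

(** The variational principle for entropy on each edge: the density G / avg G is
no better a test density for g than g / avg g.  In [gibbs_term], the terms
G avg g / avg G - g on the right have nonpositive mean on each edge. *)
Lemma gibbs_cond_ent i g G : (forall x, 0 <= g x) -> (forall x, 0 <= G x) ->
  (forall x, 0 < g x -> 0 < G x) ->
  expect (fun x => g x * (ln (G x) - ln (avg i G x))) <= cond_ent i g.
Proof.
move=> g0 G0 gG; pose F x := G x / avg i G x * avg i g x.
have FE : expect F <= expect g.
  rewrite -(expect_avg i F) -[leRHS](expect_avg i g); apply: ler_expect => x.
  rewrite {1}/avg /F !avg_flip -!mulrDl.
  have [z|z] := eqVneq (avg i G x) 0.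
    by rewrite z invr0 mulr0 !mul0r avg_ge0.
  rewrite le_eqVlt; apply/orP; left; apply/eqP.
  have -> : G x + G (flip i x) = 2 * avg i G x by rewrite /avg; field.
  by field.
have : expect (fun x => g x * (ln (G x) - ln (avg i G x)) -
    g x * ln (g x / avg i g x)) <= expect (fun x => F x - g x).
  apply: ler_expect => x; apply: gibbs_term => //; [exact: avg_ge0..|].
  by move=> gx; split; [exact: avg_gt0|exact: gG|apply: avg_gt0 => //; exact: gG].
by rewrite !expectB /cond_ent; lra.
Qed.

Definition avgs (s : seq 'I_n) g := foldr avg g s.

Lemma avgs_ge0 s g : (forall x, 0 <= g x) -> forall x, 0 <= avgs s g x.
Proof. by move=> g0; elim: s => //= i s IH x; exact: avg_ge0. Qed.

Lemma avgs_gt0 s g x : (forall x, 0 <= g x) -> 0 < g x -> 0 < avgs s g x.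
Proof.
move=> g0 gx; elim: s => //= i s IH.
by apply: avg_gt0 => //; exact: avgs_ge0.
Qed.

Lemma expect_avgs s g : expect (avgs s g) = expect g.
Proof. by elim: s => //= i s IH; rewrite expect_avg. Qed.

Lemma avgs_flip s g j x : j \in s -> avgs s g (flip j x) = avgs s g x.
Proof.
elim: s x => //= i s IH x; rewrite in_cons => /orP[/eqP ->|js].
  exact: avg_flip.
by rewrite /avg flipC !IH.
Qed.

(** Averaging over all coordinates gives a function invariant under all flips,
hence constant, and averaging preserves the expectation. *)
Lemma avgs_enum g x : avgs (index_enum 'I_n) g x = expect g.
Proof.
rewrite -(expect_avgs (index_enum 'I_n)) -(expect_cst (avgs _ g x)).
apply: eq_expect => y; apply: flip_invariant_const => i z.
by rewrite avgs_flip// mem_index_enum.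
Qed.

(** Each further average costs one conditional entropy of the original g, by
[gibbs_cond_ent] applied to the current average. *)
Lemma expect_ln_avgs s g : (forall x, 0 <= g x) ->
  expect (fun x => g x * (ln (g x) - ln (avgs s g x))) <=
  \sum_(i <- s) cond_ent i g.
Proof.
move=> g0; elim: s => [|i s IH] /=.
  rewrite big_nil (@eq_expect _ (fun=> 0)) ?expect_cst// => x.
  by rewrite subrr mulr0.
rewrite big_cons.
have := gibbs_cond_ent i g0 (avgs_ge0 s g0) (fun x => avgs_gt0 s g0).
move=> /lerD/(_ IH); apply: le_trans; rewrite -expectD.
by apply: ler_expect => x; lra.
Qed.

Lemma Ent_le_sum_cond_ent g : (forall x, 0 <= g x) -> expect g = 1 ->
  Ent g <= \sum_i cond_ent i g.
Proof.
move=> g0 g1; apply: le_trans (expect_ln_avgs (index_enum 'I_n) g0).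
by apply: ler_expect => x; rewrite avgs_enum g1 ln1 divr1 subr0.
Qed.

Lemma Ent_ge0 g : (forall x, 0 <= g x) -> expect g = 1 -> 0 <= Ent g.
Proof.
move=> g0 g1.
have -> : 0 = expect (fun x => g x - 1) by rewrite expectB expect_cst g1 subrr.
apply: ler_expect => x; rewrite g1 divr1.
have := g0 x; rewrite le_eqVlt => /orP[/eqP <-|gx]; first by rewrite mul0r; lra.
have h : ln (g x)^-1 <= (g x)^-1 - 1.
  rewrite -[X in ln X](subrK 1) addrC le_ln1Dx//.
  by have : 0 < (g x)^-1 by [rewrite invr_gt0]; lra.
have : g x * ln (g x)^-1 <= g x * ((g x)^-1 - 1).
  by apply: ler_wpM2l => //; exact: ltW.
by rewrite lnV ?posrE// mulrBr divff ?gt_eqF//; lra.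
Qed.

Lemma sum_cube g : expect g = 1 -> \sum_x g x = 2 ^+ n.
Proof.
move=> g1; have := card_cube_gt0 => c0.
have : expect g * #|cube n|%:R = \sum_x g x by rewrite divfK// gt_eqF.
by rewrite g1 mul1r => <-; rewrite card_ffun card_bool card_ord natrX.
Qed.

(** A density with respect to the uniform measure is at most 2^n. *)
Lemma Ent_le g : (forall x, 0 <= g x) -> expect g = 1 ->
  Ent g <= n%:R * ln 2.
Proof.
move=> g0 g1.
have -> : n%:R * ln 2 = expect (fun x => n%:R * ln 2 * g x) :> R.
  by rewrite expectZ g1 mulr1.
apply: ler_expect => x; rewrite g1 divr1 [leRHS]mulrC.
have := g0 x; rewrite le_eqVlt => /orP[/eqP <-|gx]; first by rewrite !mul0r.
rewrite ler_pM2l// mulr_natl -lnXn// ler_ln ?posrE ?exprn_gt0//.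
by rewrite -(sum_cube g1) (bigD1 x)//= lerDl sumr_ge0.
Qed.

(** A positive density is less than 2^n, as it has mass elsewhere: at the
neighbour of x across coordinate 0, for instance. *)
Lemma Ent_lt g : (0 < n)%N -> (forall x, 0 < g x) -> expect g = 1 ->
  Ent g < n%:R * ln 2.
Proof.
move=> n0 g0 g1.
have -> : n%:R * ln 2 = expect (fun x => n%:R * ln 2 * g x) :> R.
  by rewrite expectZ g1 mulr1.
apply: ltr_expect => x; rewrite g1 divr1 [ltRHS]mulrC ltr_pM2l//.
rewrite mulr_natl -lnXn// ltr_ln ?posrE ?exprn_gt0//.
rewrite -(sum_cube g1) (bigD1 x)//= ltrDl (bigD1 (flip (Ordinal n0) x))/=.
  by rewrite ltr_pwDl// sumr_ge0// => y _; exact: ltW.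
apply/eqP => /ffunP/(_ (Ordinal n0)); rewrite ffunE eqxx.
by case: (x _).
Qed.

End Expectation.

(** * The logarithmic Sobolev inequality *)

Section CubeInequality.
Variables (R : realType) (p : R) (n : nat) (f : cube n -> R).
Hypotheses (p_neq0 : p != 0) (p_neq1 : p != 1) (n_gt0 : (0 < n)%N).
Hypotheses (f_ge0 : forall x, 0 <= f x) (f_gt0 : p < 1 -> forall x, 0 < f x).
Hypothesis f_norm : expect (fpow f p) = 1.

Let g := fpow f p.
Let g_ge0 x : 0 <= g x. Proof. exact: powR_ge0. Qed.
Let n_gt0R : 0 < n%:R :> R. Proof. by rewrite ltr0n. Qed.

(** The two-point inequality on every edge, summed, with the edge entropies
bounded below by subadditivity; this uses s >= 0. *)
Lemma minorant_dirichlet k s : 0 <= s -> minorant p k s ->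
  k + s * (n%:R^-1 * Ent g) <=
  n%:R^-1 * Num.sg (p - 1) * dirichlet f (fpow f (p - 1)).
Proof.
move=> s0 H.
suff : n%:R * k + s * Ent g <= Num.sg (p - 1) * dirichlet f (fpow f (p - 1)).
  move=> h; rewrite -mulrA ler_pdivlMl//; apply: le_trans h.
  by rewrite mulrDr mulrCA mulVKf ?gt_eqF.
have := ler_wpM2l s0 (Ent_le_sum_cond_ent g_ge0 f_norm).
move=> /(lerD (lexx (n%:R * k)))/le_trans; apply.
have -> : n%:R * k = \sum_(i < n) k by rewrite sumr_const card_ord mulr_natl.
rewrite mulr_sumr -big_split /= dirichlet_flip mulr_sumr; apply: ler_sum => i _.
rewrite cond_ent_flip -!expectZ.
have -> : k = expect (fun x => k * avg i g x) by rewrite expectZ expect_avg f_norm mulr1.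
rewrite -expectD; apply: ler_expect => x; rewrite [k * _]mulrC.
by apply: two_point => // p1; rewrite !f_gt0.
Qed.

Lemma Ent_fpow_dom : n%:R^-1 * Ent g \in b_dom p.
Proof.
have e0 : 0 <= n%:R^-1 * Ent g.
  by rewrite mulr_ge0 ?Ent_ge0 ?invr_ge0 ?ler0n.
rewrite /b_dom; case: ifPn => p1; rewrite in_itv/= e0/=.
  by rewrite ler_pdivrMl// Ent_le.
rewrite ltr_pdivrMl// Ent_lt// => x; apply: powR_gt0; apply: f_gt0.
by rewrite lt_neqAle p_neq1 leNgt.
Qed.

(** The tangent line at Ent / n gives the bound if Ent / n < ln 2.  If
Ent / n = ln 2, every tangent line gives a bound at least the energy at its point
of tangency, and these energies tend to 1/2. *)
Lemma rate_le_dirichlet : rate p (n%:R^-1 * Ent g) <=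
  n%:R^-1 * Num.sg (p - 1) * dirichlet f (fpow f (p - 1)).
Proof.
have tangent_le t : 0 <= t -> energy_profile p t +
    slope p t * (n%:R^-1 * Ent g - entropy_profile t) <=
    n%:R^-1 * Num.sg (p - 1) * dirichlet f (fpow f (p - 1)).
  move=> t0; have := minorant_dirichlet
    (ltW (slope_gt0 t p_neq0 p_neq1)) (tangent_minorant p_neq0 t0).
  by apply: le_trans; rewrite le_eqVlt; apply/orP; left; apply/eqP; ring.
have [[t t0 e]|[p1 e]] := b_dom_cases Ent_fpow_dom.
  by have := tangent_le t t0; rewrite e subrr mulr0 addr0 rate_profile.
rewrite e rate_ln2 -subr_le0.
apply: (@vanishing_bound _ _ (1 - `|2 / p - 1|)^-1) => t t0.
apply: le_trans (energy_profile_gap_le p1 t0); rewrite lerB//.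
apply: le_trans (tangent_le t t0); rewrite e lerDl mulr_ge0//.
  by rewrite ltW// slope_gt0.
by rewrite subr_ge0 ltW// entropy_profile_lt_ln2.
Qed.

End CubeInequality.

Unset Implicit Arguments.

Theorem theorem6 (R : realType) (p : R) (p_neq0 : p != 0) (p_neq1 : p != 1) :
  [set ln 2 - binent y | y in `]0, 2^-1]] = `[0, ln 2[%classic :> set R /\
  exists b : R -> R,
    [/\ forall y : R, 0 < y <= 2^-1 -> b (ln 2 - binent y) = b_formula p y,
        1 < p -> b (ln 2) = 2^-1 /\ b u @[u --> (ln 2)^'-] --> b (ln 2),
        {in b_dom p, forall u : R, 0 <= b u},
        {in b_dom p &, {homo b : u v / u < v}} &
        convex_function (E := R^o) [set` b_dom p] b] /\
    forall (n : nat) (f : cube n -> R),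
      (1 <= n)%N ->
      (forall x, 0 <= f x) ->
      (p < 1 -> forall x, 0 < f x) ->
      expect (fpow f p) = 1 ->
      n%:R^-1 * Ent (fpow f p) \in b_dom p /\
      b (n%:R^-1 * Ent (fpow f p))
        <= n%:R^-1 * Num.sg (p - 1) * dirichlet f (fpow f (p - 1)).
Proof.
split; first exact: range_entropy.
exists (rate p); split; last first.
  move=> n f n0 f0 fp f1; split; first exact: Ent_fpow_dom.
  exact: rate_le_dirichlet.
split.
- move=> y /bias_surj[t t0 <-].
  by rewrite binent_bias rate_profile// b_formula_bias.
- by move=> p1; split; [exact: rate_ln2|exact: rate_cvg_ln2].
- exact: rate_ge0.
- exact: rate_lt.
- exact: rate_convex.
Qed.
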